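(* Let $k$ be a non-negative kernel on $I$ and $\mu$ a $\sigma$-finite Borel measure on $I$. Suppose that $c_0:=\sup_{s\in I}\int_{I(s)'}k(t,s)^p\,\mu(\mathrm{d}t)$ and $$\varepsilon_0:=\lim_{\delta\downarrow0}\sup_{\substack{r,t\in I:\\ r\le t\le r+\delta}}\int_{[r,t]}k(s,r)^p\,\mu(\mathrm{d}s)$$ are finite for some $p>0$, where $I(s)':=\{t\in I\,|\,t\ge s\}$ for all $s\in I$. Then for each $\varepsilon>\varepsilon_0$ there is $\delta>0$ such that $$\sup_{\substack{r,t\in I:\\ r\le t\le r+m\delta}}\int_{[r,t]}\mathrm{R}_{k^p,\mu,n}(s,r)\,\mu(\mathrm{d}s)\le(nc_\varepsilon)^{m-1}\varepsilon^n$$ for any $m,n\in\mathbb{N}$ with $c_\varepsilon:=\max\{1,\frac{c_0}{\varepsilon}\}$. Further, the estimate remains valid if in the definitions of $c_0$ and $\varepsilon_0$ and in this estimate the suprema are replaced by essential suprema.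
   Context: $I$ is a non-degenerate interval in $\mathbb{R}$. A non-negative kernel on $I$ is a $[0,\infty]$-valued measurable function on $\{(t,s)\in I\times I: s\le t\}$. For a non-negative kernel $k$ and a $\sigma$-finite Borel measure $\mu$ on $I$ the iterated kernels are recursively defined by $\mathrm{R}_{k,\mu,1}(t,s):=k(t,s)$ and $\mathrm{R}_{k,\mu,n+1}(t,s):=\int_{[s,t]}k(t,\tilde s)\mathrm{R}_{k,\mu,n}(\tilde s,s)\,\mu(\mathrm{d}\tilde s)$; $\mathrm{R}_{k^p,\mu,n}$ is formed from the kernel $(t,s)\mapsto k(t,s)^p$. Essential suprema are with respect to $\mu$ (with respect to $\mu\otimes\mu$ for pairs $(r,t)$). *)

(* Defs.v *)
From HB Require Import structures.
From mathcomp Require Import all_boot all_order all_algebra.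
From mathcomp Require Import all_classical all_reals all_analysis.
From mathcomp Require Import measurable_realfun ess_sup_inf.

Set Implicit Arguments.
Unset Strict Implicit.
Unset Printing Implicit Defensive.

Import Order.TTheory GRing.Theory Num.Theory.
Import numFieldNormedType.Exports.

Local Open Scope classical_set_scope.
Local Open Scope ring_scope.
Local Open Scope ereal_scope.

Section kernels.
Context {R : realType}.
Notation T := (measurableTypeR R).
Implicit Types (I : set T) (k : T -> T -> \bar R).

Definition nondegenerate_interval I : Prop :=
  is_interval I /\ exists a b : R, [/\ I a, I b & (a < b)%R].

Definition triangle I : set (T * T) :=
  [set ts | [/\ I ts.1, I ts.2 & (ts.2 <= ts.1)%R]].

(* A kernel is a total function of which only the values on the triangle are
   constrained; the values elsewhere are never used below. *)
Definition nonneg_kernel I k : Prop :=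
  measurable_fun (triangle I) (fun ts : T * T => k ts.1 ts.2) /\
  forall t s, triangle I (t, s) -> 0 <= k t s.

Definition kernel_pow k (p : R) : T -> T -> \bar R := fun t s => k t s `^ p.

(* Indexed from 1 as usual; the value at index 0 is a dummy. *)
Fixpoint iterated_kernel k (mu : set T -> \bar R) (n : nat) (t s : T)
    {struct n} : \bar R :=
  match n with
  | 0%N => 0
  | 1%N => k t s
  | m.+1 => \int[mu]_(u in `[s, t]) (k t u * iterated_kernel k mu m u s)
  end.

Definition tail_integral I k (mu : set T -> \bar R) (s : T) : \bar R :=
  \int[mu]_(t in [set t | I t /\ (s <= t)%R]) k t s.

Definition segment_integral k (mu : set T -> \bar R) (rt : T * T) : \bar R :=
  \int[mu]_(s in `[rt.1, rt.2]) k s rt.1.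

Definition close_pairs I (d : R) : set (T * T) :=
  [set rt | [/\ I rt.1, I rt.2, (rt.1 <= rt.2)%R & (rt.2 <= rt.1 + d)%R]].

Definition sup_on {S : Type} (A : set S) (f : S -> \bar R) : \bar R :=
  ereal_sup [set f x | x in A].

(* Essential supremum over A of a function that is nonnegative on A, taken in
   the ordered set [0, +oo]: extending f by 0 outside A does not affect it, and
   the maximum with 0 only matters when nu vanishes identically, in which case
   ess_sup would be -oo. *)
Definition ess_sup_on {d} {S : measurableType d}
    (nu : {measure set S -> \bar R}) (A : set S) (f : S -> \bar R) : \bar R :=
  maxe 0 (ess_sup nu (patch (cst 0) A f)).

End kernels.

(* Main.v *)
(* Put F_n(r, t) = int_[r, t] R_n(s, r) mu(ds) for the kernel k^p. Tonelli gives
   F_(n+1)(r, t) = int_[r, t] R_n(u, r) F_1(u, t) mu(du). Choosing delta such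
   that F_1(u, t) <= eps for t <= u + delta, and using F_1 <= c_0 <= c_eps eps
   otherwise, one gets
     F_(n+1)(r, t) <= eps F_n(r, t) + c_eps eps F_n(r, t - delta),
   and the estimate follows by induction on m and n from
   n^m + n^(m-1) <= (n+1)^m. Only mu-almost all u matter in this argument.
   In the essential case, the bound on F_1(u, t), known a priori for almost all
   pairs, holds for almost all u and then all t, because F_1(u, .) is monotone
   and obtained from below by continuity of measures. So the exceptional set
   only concerns the first variable, and t - delta may be an arbitrary point. *)
Require Import Defs.
From HB Require Import structures.
From mathcomp Require Import all_boot all_order all_algebra.
From mathcomp Require Import all_classical all_reals all_analysis.
From mathcomp Require Import measurable_realfun ess_sup_inf.
From mathcomp Require Import ring.

Import Order.TTheory GRing.Theory Num.Theory.
Import numFieldNormedType.Exports.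

Local Open Scope classical_set_scope.
Local Open Scope ring_scope.
Local Open Scope ereal_scope.

(** * Iterates of a causal kernel on the whole line *)

Section causal_kernel.
Context {R : realType}.
Notation T := (measurableTypeR R).
Context (mu : {sigma_finite_measure set T -> \bar R}) (K : T -> T -> \bar R).

(* Indexed from 0: [kernel_iter n] is the (n+1)-st iterated kernel. *)
Fixpoint kernel_iter (n : nat) (t s : T) : \bar R :=
  if n is m.+1 then \int[mu]_u (K t u * kernel_iter m u s) else K t s.

(** Plays the role of F_(n+1)(r, x): for a causal kernel the integrand vanishes when s < r, so a
    half-line may replace [r, x] and the domain no longer depends on r. *)
Definition head_integral (n : nat) (r x : T) : \bar R :=
  \int[mu]_(s in `]-oo, x]) kernel_iter n s r.

Hypothesis mK : measurable_fun setT (fun ts : T * T => K ts.1 ts.2).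
Hypothesis K_ge0 : forall t s, 0 <= K t s.
Hypothesis K_causal : forall t s, (t < s)%R -> K t s = 0.

Lemma kernel_iter_ge0 n t s : 0 <= kernel_iter n t s.
Proof.
elim: n t s => [|n IH] t s /=; first exact: K_ge0.
by apply: integral_ge0 => u _; rewrite mule_ge0.
Qed.

Lemma kernel_iter_causal n t s : (t < s)%R -> kernel_iter n t s = 0.
Proof.
elim: n t s => [|n IH] t s ts /=; first exact: K_causal.
apply: integral0_eq => u _; have [tu|ut] := ltP t u.
  by rewrite K_causal// mul0e.
by rewrite IH ?mule0//; exact: le_lt_trans ts.
Qed.

Lemma measurable_kernel_iter n :
  measurable_fun setT (fun ts : T * T => kernel_iter n ts.1 ts.2).
Proof.
elim: n => [|n IH] //=.
pose f (z : (T * T) * T) := K z.1.1 z.2 * kernel_iter n z.2 z.1.2.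
apply: (@measurable_fun_fubini_tonelli_F _ _ (T * T)%type T R mu f).
  have m1 : measurable_fun setT (fun z : (T * T) * T => (z.1.1, z.2)).
    apply: measurable_fun_pair; last exact: measurable_snd.
    exact: measurableT_comp measurable_fst measurable_fst.
  have m2 : measurable_fun setT (fun z : (T * T) * T => (z.2, z.1.2)).
    apply: measurable_fun_pair; first exact: measurable_snd.
    exact: measurableT_comp measurable_snd measurable_fst.
  by apply: emeasurable_funM;
    [exact: (measurableT_comp mK m1)|exact: (measurableT_comp IH m2)].
by move=> z; rewrite /f mule_ge0 ?kernel_iter_ge0.
Qed.

Lemma measurable_kernel_iterl n r :
  measurable_fun setT (fun s => kernel_iter n s r).
Proof.
exact: measurableT_comp (measurable_kernel_iter n) (pair2_measurable r).
Qed.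

Lemma head_integral_ge0 n r x : 0 <= head_integral n r x.
Proof. by apply: integral_ge0 => s _; exact: kernel_iter_ge0. Qed.

Lemma head_integral_causal n r x : (x < r)%R -> head_integral n r x = 0.
Proof.
move=> xr; apply: integral0_eq => s /=; rewrite in_itv/= => sx.
by apply: kernel_iter_causal; exact: le_lt_trans xr.
Qed.

(** Tonelli, with the restriction to s <= x written as an indicator factor so that both integrals
    run over the whole line. Integrating [K s u] in s first leaves [head_integral 0 u x]. *)
Lemma head_integralS n r x :
  head_integral n.+1 r x = \int[mu]_u (kernel_iter n u r * head_integral 0 u x).
Proof.
have mi : measurable_fun setT
    (fun s : T => (\1_(`]-oo, x]%classic : set T) s)%:E : \bar R).
  by apply/measurable_EFinP; apply: measurable_indic; exact: measurable_itv.
pose f (z : T * T) :=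
  (\1_(`]-oo, x]%classic : set T) z.1)%:E * (K z.1 z.2 * kernel_iter n z.2 r).
have f_ge0 z : 0 <= f z by rewrite /f !mule_ge0 ?kernel_iter_ge0.
have mf : measurable_fun setT f.
  apply: emeasurable_funM.
    exact: (measurableT_comp mi measurable_fst).
  apply: emeasurable_funM; first exact: mK.
  exact: (measurableT_comp (measurable_kernel_iterl n r) measurable_snd).
transitivity (\int[mu]_s \int[mu]_u f (s, u)).
  rewrite /head_integral integral_mkcond; apply: eq_integral => s _.
  rewrite patchE /f /= indicE.
  case: ifPn => sx; first by under [RHS]eq_integral do rewrite mul1e.
  by under [RHS]eq_integral do rewrite mul0e; rewrite integral0.
rewrite (fubini_tonelli f)//; apply: eq_integral => u _.
rewrite /f/= [X in _ * X]integral_mkcond -ge0_integralZl//; last 3 first.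
- rewrite -(measurable_restrictT (fun s => K s u)); last exact: measurable_itv.
  by apply: measurable_funTS; exact: (measurable_kernel_iterl 0 u).
- by move=> s _; apply: erestrict_ge0 => ? _; exact: K_ge0.
- exact: kernel_iter_ge0.
apply: eq_integral => s _; rewrite patchE indicE.
by case: ifPn => _; rewrite ?mul1e ?mul0e ?mule0// muleC.
Qed.

(** The first bound will come from eps_0, the second from c_0. The endpoints are quantified inside,
    so an exceptional null set concerns the starting point u alone. *)
Definition tame_start (I : set T) (delta eps C : R) (u : T) : Prop :=
  (forall x : R, I x -> (u <= x)%R -> (x <= u + delta)%R ->
    head_integral 0 u x <= eps%:E) /\
  forall x, head_integral 0 u x <= C%:E.

(* In the Tonelli formula [head_integralS] the starting points u in
   [x - delta, x] contribute at most eps and the earlier ones at most C. *)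
Lemma head_integral_step (I : set T) (delta eps C : R) n (r x : R) :
  (0 <= eps)%R -> (0 <= C)%R -> I x ->
  {ae mu, forall u, tame_start I delta eps C u} ->
  head_integral n.+1 r x <= eps%:E * head_integral n r x +
    C%:E * \int[mu]_(u in `]-oo, (x - delta)%R[) kernel_iter n u r.
Proof.
move=> eps_ge0 C_ge0 Ix tame.
have mk (A : set T) : measurable A ->
    measurable_fun setT ((fun u => kernel_iter n u r) \_ A).
  move=> mA'; apply/(measurable_restrictT _ mA').
  by apply: measurable_funTS; exact: measurable_kernel_iterl.
have k_ge0 (A : set T) u : 0 <= ((fun u => kernel_iter n u r) \_ A) u.
  by apply: erestrict_ge0 => ? _; exact: kernel_iter_ge0.
rewrite head_integralS [head_integral n r x]/head_integral.
rewrite [X in _ * X + _]integral_mkcond [X in _ + _ * X]integral_mkcond.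
rewrite -!ge0_integralZl ?lee_fin//; [|exact: mk|exact: mk].
rewrite -ge0_integralD//; last 4 first.
- by move=> u _; apply: mule_ge0; rewrite ?lee_fin.
- by apply: measurable_funeM; exact: mk.
- by move=> u _; apply: mule_ge0; rewrite ?lee_fin.
- by apply: measurable_funeM; exact: mk.
apply: ae_ge0_le_integral => //.
- by move=> u _; rewrite mule_ge0 ?kernel_iter_ge0 ?head_integral_ge0.
- apply: emeasurable_funM; first exact: measurable_kernel_iterl.
  (* Measurability in u follows from Tonelli, the half-line being again an indicator factor. *)
  pose f (z : T * T) := K z.1 z.2 * (\1_(`]-oo, x]%classic : set T) z.1)%:E.
  rewrite (_ : (fun u => _) = fun u => \int[mu]_s f (s, u)); last first.
    apply/funext => u; rewrite /head_integral integral_mkcond.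
    apply: eq_integral => s _; rewrite patchE /f indicE /=.
    by case: ifPn; rewrite ?mule1 ?mule0.
  apply: (@measurable_fun_fubini_tonelli_G _ _ T T R mu f); last first.
    by move=> z; rewrite /f mule_ge0.
  apply: emeasurable_funM; first exact: mK.
  have mi : measurable_fun setT
      (fun s : T => (\1_(`]-oo, x]%classic : set T) s)%:E : \bar R).
    by apply/measurable_EFinP; apply: measurable_indic; exact: measurable_itv.
  exact: (measurableT_comp mi measurable_fst).
- by move=> u _; rewrite adde_ge0// mule_ge0 ?lee_fin.
- by apply: emeasurable_funD; apply: measurable_funeM; exact: mk.
apply: filterS tame => u [near_u far_u] _.
rewrite !patchE !mem_setE !in_itv/=.
(* Starting points beyond x contribute nothing, by causality. *)
have [ux|xu] := leP u x; last first.
  rewrite head_integral_causal// mule0 mule0 add0e.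
  by rewrite mule_ge0 ?lee_fin//; case: ifPn => _ //; exact: kernel_iter_ge0.
have [uxd|xdu] := ltP u (x - delta)%R.
  rewrite muleC (le_trans (lee_wpmul2r _ (far_u x))) ?kernel_iter_ge0//.
  by rewrite leeDr// mule_ge0 ?lee_fin// kernel_iter_ge0.
rewrite mule0 adde0 muleC lee_wpmul2r ?kernel_iter_ge0//.
by apply: near_u => //; rewrite -lerBlDr.
Qed.

Lemma le_head_integral n r (x y : R) : (x <= y)%R ->
  \int[mu]_(u in `]-oo, x[) kernel_iter n u r <= head_integral n r y.
Proof.
move=> xy; apply: (@ge0_subset_integral _ _ _ mu).
- exact: measurable_itv.
- exact: measurable_itv.
- by apply: measurable_funTS; exact: measurable_kernel_iterl.
- by move=> s _; exact: kernel_iter_ge0.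
- by move=> s /=; rewrite !in_itv/= => /ltW/le_trans; apply.
Qed.

(** Outer induction on m for all n and x, inner induction on n with r and x fixed: the case (m+1,
    n+1) at x reduces to (m+1, n) at x and (m, n) at x - delta. Both indices are shifted by one, so
    the exponent m - 1 becomes m. *)
Lemma head_integral_bound (I : set T) (delta eps c : R) :
  is_interval I -> (0 < delta)%R -> (0 <= eps)%R -> (1 <= c)%R ->
  {ae mu, forall u, tame_start I delta eps (c * eps) u} ->
  forall (m n : nat) (r x : R), tame_start I delta eps (c * eps) r ->
  I r -> I x -> (r <= x)%R -> (x <= r + m.+1%:R * delta)%R ->
  head_integral n r x <= ((n.+1%:R * c) ^+ m * eps ^+ n.+1)%:E.
Proof.
move=> itvI delta_gt0 eps_ge0 c_ge1 tame m.
have c_ge0 : (0 <= c)%R by exact: le_trans c_ge1.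
have step := fun n r x Ix => head_integral_step _ _ _ _ n r x eps_ge0
  (mulr_ge0 c_ge0 eps_ge0) Ix tame.
elim: m => [|m IHm] n r x tr Ir Ix rx.
  rewrite mul1r expr0 mul1r => xr.
  elim: n => [|n IHn]; first by rewrite expr1; apply: tr.1.
  apply: le_trans (step _ _ _ Ix) _.
  (* As x <= r + delta, everything before x - delta lies before r, where the iterated kernel
     vanishes. *)
  rewrite [X in _ + _ * X]integral0_eq ?mule0 ?adde0; last first.
    move=> u /=; rewrite in_itv/= => ux; apply: kernel_iter_causal.
    by rewrite (lt_le_trans ux)// lerBlDr.
  by rewrite exprS EFinM lee_wpmul2l ?lee_fin.
move=> xr; elim: n => [|n IHn].
  (* For a single kernel the far bound c eps suffices, since c <= c^(m+2) for c >= 1. *)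
  rewrite mul1r expr1; apply: le_trans (tr.2 x) _.
  by rewrite lee_fin ler_wpM2r// exprS ler_peMr// exprn_ege1.
apply: le_trans (step _ _ _ Ix) _.
have tail_le : \int[mu]_(u in `]-oo, (x - delta)%R[) kernel_iter n u r <=
    ((n.+1%:R * c) ^+ m * eps ^+ n.+1)%:E.
  have [rxd|xdr] := leP r (x - delta)%R; last first.
    rewrite integral0_eq ?lee_fin ?mulr_ge0 ?exprn_ge0 ?mulr_ge0//.
    move=> u /=; rewrite in_itv/= => ux; apply: kernel_iter_causal.
    exact: lt_trans xdr.
  apply: le_trans (le_head_integral _ _ _ _ (lexx _)) _.
  apply: IHm => //.
    by apply: (itvI _ _ Ir Ix); rewrite rxd/= gerBl ltW.
  by rewrite lerBlDr -addrA -[X in (_ + (_ + X))%R]mul1r -mulrDl natr1.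
apply: (@le_trans _ _ (eps%:E * ((n.+1%:R * c) ^+ m.+1 * eps ^+ n.+1)%:E +
    (c * eps)%:E * ((n.+1%:R * c) ^+ m * eps ^+ n.+1)%:E)).
  by apply: leeD; apply: lee_wpmul2l => //; rewrite lee_fin ?mulr_ge0.
rewrite -!EFinM -EFinD lee_fin.
(* The integer factors add up to (n+1)^(m+1) + (n+1)^m = (n+1)^m (n+2), which is at most
   (n+2)^(m+1). *)
have -> : (eps * ((n.+1%:R * c) ^+ m.+1 * eps ^+ n.+1) +
    c * eps * ((n.+1%:R * c) ^+ m * eps ^+ n.+1) =
    (n.+1%:R ^+ m * n.+2%:R) * (c ^+ m.+1 * eps ^+ n.+2))%R.
  by rewrite -[n.+2%:R]natr1 !exprMn !exprS; ring.
have ce_ge0 : (0 <= c ^+ m.+1 * eps ^+ n.+2)%R.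
  by apply: mulr_ge0; exact: exprn_ge0.
rewrite exprMn -[leRHS]mulrA; apply: ler_wpM2r => //.
by rewrite exprSr ler_wpM2r// lerXn2r ?nnegrE ?ler_nat.
Qed.

End causal_kernel.

(** * Null sets of the product measure and integrals over half-lines *)

Section almost_everywhere.
Context {R : realType}.
Notation T := (measurableTypeR R).
Context (mu : {sigma_finite_measure set T -> \bar R}).

(** The measures of the sections of a product-null set integrate to 0, hence vanish almost
    everywhere. *)
Lemma ae_xsection (P : T * T -> Prop) : {ae mu \x mu, forall z, P z} ->
  {ae mu, forall x, {ae mu, forall y, P (x, y)}}.
Proof.
move=> [N [mN N0 PN]].
have mphi : measurable_fun setT (mu \o xsection N).
  exact: measurable_fun_xsection.
have : ae_eq mu setT (mu \o xsection N) (cst 0).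
  apply/ae_eq_integral_abs => //; rewrite -[RHS]N0.
  by apply: eq_integral => x _; rewrite gee0_abs.
apply: filterS => x /(_ Logic.I) /= Nx0; exists (xsection N x).
split => //; first exact: measurable_xsection.
by move=> y nP; rewrite /xsection/= inE; exact: PN.
Qed.

Lemma ae_fst (P : T -> Prop) : {ae mu, forall x, P x} ->
  {ae mu \x mu, forall z : T * T, P z.1}.
Proof.
move=> [N [mN N0 PN]]; exists (N `*` setT); split.
- exact: measurableX.
- by rewrite [LHS]product_measure1E// [X in X * _]N0 mul0e.
- by move=> z nP; split => //; exact: PN.
Qed.

(* The set of good endpoints is, up to a mu-null set, a half-line, which is
   exhausted from below by half-lines with good endpoints. *)
Lemma ae_le_integral_halfline (f : T -> \bar R) (x : R) (b : \bar R) :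
  measurable_fun setT f -> (forall s, 0 <= f s) -> 0 <= b ->
  {ae mu, forall t : R, (t <= x)%R -> \int[mu]_(s in `]-oo, t]) f s <= b} ->
  \int[mu]_(s in `]-oo, x]) f s <= b.
Proof.
move=> mf f_ge0 b_ge0 good.
have mfD (D : set T) : measurable_fun D f by exact: measurable_funTS.
pose G (t : R) := \int[mu]_(s in `]-oo, t]) f s.
(* Up to a null set, ]-oo, x] consists of good endpoints and so lies in D; the bound on D then
   carries over. *)
suff [D [mD Db goodD]] : exists D : set T, [/\ measurable D,
    \int[mu]_(s in D) f s <= b & forall t : R, (t <= x)%R -> G t <= b -> D t].
  case: good => N [mN N0 badN].
  have mx : measurable (`]-oo, x]%classic : set T) by exact: measurable_itv.
  rewrite (ge0_negligible_integral mN mx (mfD _) _ N0)//.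
  apply: le_trans Db; apply: (@ge0_subset_integral _ _ _ mu) => //.
    exact: measurableD.
  move=> t /= []; rewrite in_itv/= => tx Nt; apply: goodD => //.
  by apply: contrapT => nGt; apply/Nt/badN => /(_ tx).
pose S : set R := [set t | (t <= x)%R /\ G t <= b].
(* Without good endpoints the half-line is itself null. *)
have [S0|/set0P S0] := eqVneq S set0.
  exists set0; split; rewrite ?integral_set0// => t tx Gt.
  by rewrite -S0.
have hS : has_sup S by split => //; exists x => t [].
have leS t : S t -> (t <= sup S)%R by move=> St; exact: (sup_upper_bound hS).
have [Gs|nGs] := pselect (G (sup S) <= b).
  exists `]-oo, (sup S)]%classic; split => //.
  by move=> t tx Gt; rewrite /= in_itv/=; exact: leS.
(* If the supremum is not good, it is not attained. The open half-line is then the increasing union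
   of the [F n], each contained in a half-line with a good endpoint. *)
exists `]-oo, (sup S)[%classic; split; first exact: measurable_itv.
  pose F (n : nat) : set T := `]-oo, (sup S - n.+1%:R^-1)%R]%classic.
  have ndF : nondecreasing_seq F.
    move=> i j ij; rewrite subsetEset => t; rewrite /F/= !in_itv/= => ti.
    rewrite (le_trans ti)// lerD2l lerN2.
    by rewrite lef_pV2 ?posrE ?ltr0n// ler_nat.
  have mF i : measurable (F i) by exact: measurable_itv.
  have := @ge0_nondecreasing_set_cvg_integral _ T R F f mu ndF mF
    (fun i => mfD (F i)) (fun _ s _ => f_ge0 s).
  have <- : `]-oo, (sup S)[%classic = \bigcup_i F i.
    apply/seteqP; split => t /=; rewrite in_itv/=.
      (* The exhaustion of [t, sup S) by closed intervals supplies n with t <= sup S - 1/(n+1). *)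
      move=> ts; have [n _] : (\bigcup_n [set` `[t, (sup S - n.+1%:R^-1)%R]]) t.
        by rewrite -itv_bnd_open_bigcup/= in_itv/= lexx.
      by rewrite /= in_itv/= lexx/= => tn; exists n => //; rewrite /F/= in_itv.
    move=> [n _]; rewrite /F/= in_itv/= => /le_lt_trans; apply.
    by rewrite ltrBlDr ltrDl invr_gt0 ltr0n.
  move=> cvF; rewrite -(cvg_lim _ cvF)//; apply: lime_le.
    by apply/cvg_ex; eexists; exact: cvF.
  apply: nearW => n.
  have n_gt0 : (0 < n.+1%:R^-1 :> R)%R by rewrite invr_gt0 ltr0n.
  have [t [tx Gt] ts] := sup_adherent n_gt0 hS.
  apply: le_trans Gt; apply: (@ge0_subset_integral _ _ _ mu) => //.
  by move=> s; rewrite /F/= !in_itv/= => /le_trans -> //; exact: ltW.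
move=> t tx Gt; rewrite /= in_itv/= lt_neqAle leS// andbT.
by apply: contra_notN nGs => /eqP <-.
Qed.

End almost_everywhere.

(** By monotonicity the right-hand limit exists and is the infimum of the values to the right of
    a. *)
Lemma lim_at_right_lt (R : realType) (g : R -> \bar R) (a : R) (e : \bar R) :
  {homo g : x y / (x <= y)%R >-> x <= y} ->
  lim (g d @[d --> a^'+]) < e -> exists2 d : R, (a < d)%R & g d < e.
Proof.
move=> ndg.
have cvg_g : g d @[d --> a^'+] -->
    ereal_inf (g @` [set` Interval (BRight a) +oo%O]).
  by apply: nondecreasing_at_right_cvge => // x y _ _; exact: ndg.
rewrite (cvg_lim _ cvg_g)//.
move=> /ereal_inf_lt[_ [d + <-] gd].
by rewrite /= in_itv/= andbT => ad; exists d.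
Qed.

(** * Transfer between the interval and the whole line *)

Section segment_bound.
Context {R : realType}.
Notation T := (measurableTypeR R).
Context (I : set T) (mu : {sigma_finite_measure set T -> \bar R}).
Context (q : T -> T -> \bar R).

(** The extension is causal and measurable on the whole plane, as the results on causal kernels
    require. *)
Definition extend_by_0 (t s : T) : \bar R :=
  ((fun ts : T * T => q ts.1 ts.2) \_ (triangle I)) (t, s).

Hypothesis itvI : is_interval I.
Hypothesis mq : measurable_fun (triangle I) (fun ts : T * T => q ts.1 ts.2).
Hypothesis q_ge0 : forall t s, 0 <= q t s.

Let K := extend_by_0.

Lemma extend_by_0E t s : triangle I (t, s) -> K t s = q t s.
Proof. by move=> tri; rewrite /K /extend_by_0 patchE mem_set. Qed.

Lemma extend_by_0_out t s : ~ triangle I (t, s) -> K t s = 0.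
Proof. by move=> ntri; rewrite /K /extend_by_0 patchE memNset. Qed.

Lemma extend_by_0_ge0 t s : 0 <= K t s.
Proof. by apply: erestrict_ge0 => ts _; exact: q_ge0. Qed.

Lemma extend_by_0_causal t s : (t < s)%R -> K t s = 0.
Proof.
by move=> ts; apply: extend_by_0_out => -[_ _ /=]; rewrite leNgt ts.
Qed.

Lemma measurable_triangle : measurable (triangle I).
Proof.
have mI : measurable I by exact: is_interval_measurable.
have -> : triangle I = (I `*` I) `&`
    [set ts : T * T | (ts.2 : R) <= ts.1]%R.
  apply/seteqP; split => [ts [It Is st]|ts [[It Is] st]]; first by split.
  by split.
apply: measurableI; first exact: measurableX.
rewrite -[X in measurable X]setTI.
have mle : measurable_fun setT (fun ts : T * T => (ts.2 : R) <= ts.1)%R.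
  by apply: measurable_fun_ler; [exact: measurable_snd|exact: measurable_fst].
exact: (mle measurableT [set true]).
Qed.

Lemma measurable_extend_by_0 :
  measurable_fun setT (fun ts : T * T => K ts.1 ts.2).
Proof.
have := (measurable_restrictT (fun ts : T * T => q ts.1 ts.2)
  measurable_triangle).1 mq.
by apply: eq_measurable_fun => -[].
Qed.

(** For u outside [s, t] a factor of the integrand vanishes by causality; for u inside, convexity of
    I keeps (t, u) and (u, s) in the triangle. *)
Lemma iterated_kernelE n t s : triangle I (t, s) ->
  iterated_kernel q mu n.+1 t s = kernel_iter mu K n t s.
Proof.
elim: n t s => [|n IH] t s tri; first by rewrite /= extend_by_0E.
transitivity (\int[mu]_(u in `[s, t]) (q t u * iterated_kernel q mu n.+1 u s)).
  by [].
rewrite integral_mkcond; apply: eq_integral => u _; rewrite patchE.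
case: (tri) => /= It Is st.
rewrite -[RHS]/(K t u * kernel_iter mu K n u s).
have -> : (u \in (`[s, t]%classic : set T)) = (s <= u <= t)%R.
  by rewrite mem_setE in_itv.
case: ifPn => [/andP[su ut]|].
  have Iu : I u by apply: (itvI _ _ Is It); rewrite su.
  by rewrite -IH // extend_by_0E.
rewrite negb_and -!ltNge => /orP[us|tu].
  by rewrite (kernel_iter_causal _ _ extend_by_0_causal)// mule0.
by rewrite [K t u]extend_by_0_causal// mul0e.
Qed.

Lemma segment_integralE n (r t : R) : I r -> I t ->
  segment_integral (iterated_kernel q mu n.+1) mu (r, t) =
  head_integral mu K n r t.
Proof.
move=> Ir It; rewrite /segment_integral /head_integral.
rewrite integral_mkcond [RHS]integral_mkcond; apply: eq_integral => s _.
rewrite !patchE.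
have -> : (s \in (`[r, t]%classic : set T)) = ((r <= s) && (s <= t))%R.
  by rewrite mem_setE in_itv.
have -> : (s \in (`]-oo, t]%classic : set T)) = (s <= t)%R.
  by rewrite mem_setE in_itv.
have [rs|sr] := leP r s; last first.
  by rewrite (kernel_iter_causal _ _ extend_by_0_causal)//; case: ifP.
case: (leP s t) => [st|//]; apply: iterated_kernelE; split => //=.
by apply: (itvI _ _ Ir It); rewrite rs.
Qed.

Lemma le_head_tail (r t : R) : I r ->
  head_integral mu K 0 r t <= tail_integral I q mu r.
Proof.
move=> Ir; have -> : tail_integral I q mu r = \int[mu]_s K s r.
  rewrite /tail_integral integral_mkcond; apply: eq_integral => s _.
  rewrite patchE; case: ifPn => [|/negP].
    by rewrite inE => -[Is rs]; rewrite extend_by_0E.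
  by rewrite inE => ns; rewrite extend_by_0_out// => -[/= Is _ rs]; apply: ns.
apply: (@ge0_subset_integral _ _ _ mu) => //.
- exact: (measurable_kernel_iterl mu _
    measurable_extend_by_0 extend_by_0_ge0 0 r).
- by move=> s _; exact: extend_by_0_ge0.
Qed.

(** The counterpart of [tame_start] for the integrals that define eps_0 and c_0. *)
Definition tame_at (delta eps C : R) (u : T) : Prop :=
  (forall t : R, close_pairs I delta (u, t) ->
    segment_integral q mu (u, t) <= eps%:E) /\
  tail_integral I q mu u <= C%:E.

Lemma tame_at_start (delta eps C u : R) : I u -> tame_at delta eps C u ->
  tame_start mu K I delta eps C u.
Proof.
move=> Iu [near_u far_u]; split=> [x Ix ux xu|x].
  by rewrite -(segment_integralE 0)//; exact: near_u.
exact: le_trans (le_head_tail _ _ Iu) far_u.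
Qed.

Lemma segment_iterated_bound (delta eps c : R) :
  (0 < delta)%R -> (0 <= eps)%R -> (1 <= c)%R ->
  {ae mu, forall u : T, I u -> tame_at delta eps (c * eps) u} ->
  forall (m n : nat) (r t : R), (0 < m)%N -> (0 < n)%N ->
  tame_at delta eps (c * eps) r -> close_pairs I (m%:R * delta) (r, t) ->
  segment_integral (iterated_kernel q mu n) mu (r, t) <=
    ((n%:R * c) ^+ (m - 1)%N * eps ^+ n)%:E.
Proof.
move=> delta_gt0 eps_ge0 c_ge1 tame [//|m] [//|n] r t _ _ tr.
move=> [/= Ir It rt tr']; rewrite segment_integralE// subn1/=.
have ce_ge0 : (0 <= c * eps)%R by rewrite mulr_ge0// (le_trans _ c_ge1).
apply: (head_integral_bound mu K measurable_extend_by_0 extend_by_0_ge0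
  extend_by_0_causal I delta eps c) => //; last exact: tame_at_start.
apply: filterS tame => u tame_u.
have [Iu|nIu] := pselect (I u); first exact: tame_at_start (tame_u Iu).
(* Starting points outside I are tame because the extended kernel vanishes there. *)
have head0 x : head_integral mu K 0 u x = 0.
  by apply: integral0_eq => s _; apply: extend_by_0_out => -[].
by split=> [x _ _ _|x]; rewrite head0 lee_fin.
Qed.

(** Sectioning turns almost all pairs into almost all t for almost all u; [ae_le_integral_halfline]
    then reaches every t. *)
Lemma ae_segment_le (delta : R) (eps : \bar R) : 0 <= eps ->
  {ae mu \x mu, forall z, close_pairs I delta z ->
    segment_integral q mu z <= eps} ->
  {ae mu, forall u : T, I u -> forall t : R, close_pairs I delta (u, t) ->
    segment_integral q mu (u, t) <= eps}.
Proof.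
move=> eps_ge0 /ae_xsection; apply: filterS => u near_u Iu x [/= _ Ix ux xu].
rewrite (segment_integralE 0)//; apply: ae_le_integral_halfline => //.
- exact: (measurable_kernel_iterl mu _
    measurable_extend_by_0 extend_by_0_ge0 0 u).
- by move=> s; exact: extend_by_0_ge0.
apply: filterS near_u => t near_ut tx.
have [ut|tu] := leP u t; last first.
  by rewrite [leLHS](head_integral_causal _ _ extend_by_0_causal 0).
have It : I t by apply: (itvI _ _ Iu Ix); rewrite ut.
rewrite -[leLHS]/(head_integral mu K 0 u t) -segment_integralE//.
by apply: near_ut; split => //=; exact: le_trans xu.
Qed.

End segment_bound.

(** * Suprema and essential suprema over close pairs *)

Section suprema.
Context {R : realType}.
Notation T := (measurableTypeR R).
Implicit Types (I : set T) (x y : R).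

Lemma close_pairs_homo I x y : (x <= y)%R ->
  close_pairs I x `<=` close_pairs I y.
Proof.
by move=> xy [r t] [Ir It rt tr]; split => //; rewrite (le_trans tr)// lerD2l.
Qed.

Lemma sup_on_close_pairs_homo I (f : T * T -> \bar R) :
  {homo (fun d : R => sup_on (close_pairs I d) f) :
    x y / (x <= y)%R >-> x <= y}.
Proof.
move=> x y xy; apply: le_ereal_sup => _ [rt rt_close <-]; exists rt => //.
exact: close_pairs_homo xy _ rt_close.
Qed.

(** Enlarging the set of pairs replaces the value 0 of [patch] by values of f, which is an increase
    as f is nonnegative. *)
Lemma ess_sup_on_close_pairs_homo (nu : {measure set (T * T)%type -> \bar R}) I
    (f : T * T -> \bar R) : (forall z, 0 <= f z) ->
  {homo (fun d : R => ess_sup_on nu (close_pairs I d) f) :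
    x y / (x <= y)%R >-> x <= y}.
Proof.
move=> f_ge0 x y xy; rewrite /ess_sup_on ge_max le_max lexx/= le_max.
apply/orP; right; apply: le_ess_sup; apply: nearW => z; rewrite !patchE.
case: ifPn => [|_]; last by case: ifP.
by rewrite inE => /(close_pairs_homo _ _ _ xy) zy; rewrite mem_set.
Qed.

Lemma ess_sup_on_le d (S : measurableType d) (nu : {measure set S -> \bar R})
    (A : set S) (f : S -> \bar R) (b : \bar R) :
  ess_sup_on nu A f <= b -> {ae nu, forall z, A z -> f z <= b}.
Proof.
rewrite /ess_sup_on ge_max => /andP[_ /ess_supP]; apply: filterS => z.
by rewrite patchE => + Az; rewrite mem_set.
Qed.

End suprema.

(* A sigma-finite Borel measure on I is identified with its extension by zero
   to the real line. *)
Theorem proposition4p3 (R : realType) (I : set (measurableTypeR R))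
    (hI : nondegenerate_interval I)
    (k : measurableTypeR R -> measurableTypeR R -> \bar R)
    (hk : nonneg_kernel I k)
    (mu : {sigma_finite_measure set (measurableTypeR R) -> \bar R})
    (hmu : mu (~` I) = 0)
    (p : R) (hp : (0 < p)%R) :
  (let c0 := sup_on I (tail_integral I (kernel_pow k p) mu) in
   let eps0 := lim (sup_on (close_pairs I d)
                      (segment_integral (kernel_pow k p) mu) @[d --> 0^'+]) in
   c0 \is a fin_num -> eps0 \is a fin_num ->
   forall eps : R, eps0 < eps%:E ->
   let c_eps := Num.max 1%R (fine c0 / eps)%R in
   exists2 delta : R, (0 < delta)%R &
     forall m n : nat, (0 < m)%N -> (0 < n)%N ->
       sup_on (close_pairs I (m%:R * delta))
         (segment_integral (iterated_kernel (kernel_pow k p) mu n) mu)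
       <= ((n%:R * c_eps) ^+ (m - 1)%N * eps ^+ n)%:E)
  /\
  (let c0 := ess_sup_on mu I (tail_integral I (kernel_pow k p) mu) in
   let eps0 := lim (ess_sup_on (mu \x mu) (close_pairs I d)
                      (segment_integral (kernel_pow k p) mu) @[d --> 0^'+]) in
   c0 \is a fin_num -> eps0 \is a fin_num ->
   forall eps : R, eps0 < eps%:E ->
   let c_eps := Num.max 1%R (fine c0 / eps)%R in
   exists2 delta : R, (0 < delta)%R &
     forall m n : nat, (0 < m)%N -> (0 < n)%N ->
       ess_sup_on (mu \x mu) (close_pairs I (m%:R * delta))
         (segment_integral (iterated_kernel (kernel_pow k p) mu n) mu)
       <= ((n%:R * c_eps) ^+ (m - 1)%N * eps ^+ n)%:E).
Proof.
set q := kernel_pow k p.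
have itvI := hI.1.
have q_ge0 t s : 0 <= q t s by exact: poweR_ge0.
have mq : measurable_fun (triangle I)
    (fun ts : measurableTypeR R * measurableTypeR R => q ts.1 ts.2).
  exact: measurableT_comp (measurable_poweR p) hk.1.
have seg_ge0 rt : 0 <= segment_integral q mu rt.
  by apply: integral_ge0 => s _; exact: q_ge0.
have bound := segment_iterated_bound I mu q itvI mq q_ge0.
have c_ge1 (c0 eps : R) : (1 <= Num.max 1 (c0 / eps))%R.
  by rewrite le_max lexx.
(* The quotient in c_eps serves to write the far bound c_0 in the form c_eps eps. *)
have c_far (c0 eps : R) : (0 < eps)%R -> (c0 <= Num.max 1 (c0 / eps) * eps)%R.
  by move=> eps_gt0; rewrite -ler_pdivrMr// le_max lexx orbT.
split=> c0 eps0 c0_fin _ eps eps0_lt c_eps.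
- have [delta delta_gt0 sup_lt] := lim_at_right_lt _ _ _ _
    (sup_on_close_pairs_homo _ _) eps0_lt.
  have near_le rt : close_pairs I delta rt ->
      segment_integral q mu rt <= eps%:E.
    move=> rt_close; apply: le_trans (ltW sup_lt).
    by apply: ereal_sup_ubound; exists rt.
  have eps_gt0 : (0 < eps)%R.
    (* A diagonal pair (a, a) is close, so the supremum is nonnegative and eps exceeds it. *)
    have [_ [a [_ [Ia _ _]]]] := hI.
    rewrite -lte_fin; apply: le_lt_trans sup_lt.
    apply: le_trans (seg_ge0 (a, a)) _; apply: ereal_sup_ubound.
    by exists (a, a) => //; split; rewrite //= lerDl ltW.
  have tame u : I u -> tame_at I mu q delta eps (c_eps * eps) u.
    move=> Iu; split=> [t ut|]; first exact: near_le.
    apply: (@le_trans _ _ c0); first by apply: ereal_sup_ubound; exists u.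
    by rewrite -(fineK c0_fin) lee_fin; exact: c_far.
  exists delta => // m n m_gt0 n_gt0.
  apply: ub_ereal_sup => _ [[r t] rt_close <-].
  apply: (bound delta eps c_eps delta_gt0 (ltW eps_gt0) (c_ge1 _ _)) => //.
    exact: nearW.
  by apply: tame; case: rt_close.
- have [delta delta_gt0 sup_lt] := lim_at_right_lt _ _ _ _
    (ess_sup_on_close_pairs_homo _ _ _ seg_ge0) eps0_lt.
  have eps_gt0 : (0 < eps)%R.
    (* Here positivity comes from the maximum with 0 in [ess_sup_on]. *)
    by rewrite -lte_fin; apply: le_lt_trans sup_lt; rewrite le_max lexx.
  have near_le : {ae mu \x mu, forall z, close_pairs I delta z ->
      segment_integral q mu z <= eps%:E}.
    by apply: ess_sup_on_le; exact: ltW.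
  have tame :
      {ae mu, forall u, I u -> tame_at I mu q delta eps (c_eps * eps) u}.
    have far_le : {ae mu, forall u, I u -> tail_integral I q mu u <= c0}.
      exact: ess_sup_on_le.
    have := ae_segment_le I mu q itvI mq q_ge0 delta eps%:E (ltW _) near_le.
    move=> /(_ eps_gt0); apply: filterS2 far_le => u far_u near_u Iu.
    split=> [|]; first exact: near_u.
    apply: le_trans (far_u Iu) _.
    by rewrite -(fineK c0_fin) lee_fin; exact: c_far.
  exists delta => // m n m_gt0 n_gt0.
  (* Serves both the maximum with 0 and the value 0 of [patch] off the close pairs. *)
  have bound_ge0 : 0 <= ((n%:R * c_eps) ^+ (m - 1)%N * eps ^+ n)%:E.
    have c_ge0 : (0 <= c_eps)%R by exact: le_trans ler01 (c_ge1 _ _).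
    rewrite lee_fin; apply: mulr_ge0; apply: exprn_ge0; last exact: ltW.
    exact: mulr_ge0.
  rewrite /ess_sup_on ge_max bound_ge0/=.
  (* The pairs with an exceptional first entry r form a product-null set; for every other r in I the
     bound holds for all t. *)
  apply/ess_supP; apply: filterS (ae_fst _ _ tame) => -[r t] /= tame_r.
  rewrite patchE; case: ifPn => [|//].
  rewrite inE => rt_close.
  apply: (bound delta eps c_eps delta_gt0 (ltW eps_gt0) (c_ge1 _ _)) => //.
  by apply: tame_r; case: rt_close.
Qed.
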